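(* Let $d\ge1$ be an integer. (1) Let $\mu,\nu\in\mathcal{P}_2(\mathbb{R}^d)$ share the same barycentre, i.e. $[\mu]=[\nu]$. Then $$Z_2(\mu,\nu)\ \le\ \frac12\,(\sigma_\mu+\sigma_\nu)\,W_2(\mu,\nu).$$ (2) This upper bound is optimal in the following sense: for all $a,b\ge0$, the quantity $$h(a,b):=\sup\Big\{\frac{Z_2(\mu,\nu)}{W_2(\mu,\nu)}\ :\ \mu,\nu\in\mathcal{P}_2(\mathbb{R}^d),\ \sigma_\mu\le a,\ \sigma_\nu\le b,\ \mu\ne\nu,\ [\mu]=[\nu]=0\Big\}$$ (with the convention $\sup\emptyset=0$) satisfies $h(a,b)=\frac12(a+b)$. (3) For $\mu,\nu\in\mathcal{P}_2(\mathbb{R}^d)$ with $[\mu]=[\nu]$, the inequality in (1) is an equality if and only if $\mu$ and $\nu$ coincide up to a dilation centred at their common barycentre, i.e., writing $m=[\mu]=[\nu]$, there exists $\lambda\ge0$ such that $\nu$ is the push-forward of $\mu$, or $\mu$ is the push-forward of $\nu$, by the map $x\mapsto m+\lambda(x-m)$.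
   Context: $\mathcal{P}_2(\mathbb{R}^d)$ is the set of Borel probability measures $\mu$ on $\mathbb{R}^d$ with $\int|x|^2\,\mu(dx)<+\infty$, where $|\cdot|$ is the Euclidean norm. $[\mu]=\int x\,\mu(dx)$ is the barycentre, $\mathrm{var}(\mu)=\int|x-[\mu]|^2\,\mu(dx)$ the variance, and $\sigma_\mu=\sqrt{\mathrm{var}(\mu)}$ the standard deviation. $\Gamma(\mu,\nu)$ is the set of Borel probability measures on $\mathbb{R}^d\times\mathbb{R}^d$ with first marginal $\mu$ and second marginal $\nu$. The Wasserstein distance is $$W_2(\mu,\nu)=\Big(\inf\Big\{\iint|x-y|^2\,\gamma(dxdy)\,:\,\gamma\in\Gamma(\mu,\nu)\Big\}\Big)^{1/2}.$$ $C^{1,1}(\mathbb{R}^d)$ is the space of continuously differentiable functions $u:\mathbb{R}^d\to\mathbb{R}$ whose gradient is Lipschitz, and $\mathrm{lip}(\nabla u)$ denotes the (Euclidean) Lipschitz constant of $\nabla u$. The second-order Zolotarev distance between measures with $[\mu]=[\nu]$ is $$Z_2(\mu,\nu)=\sup\Big\{\int u\,d(\nu-\mu)\,:\,u\in C^{1,1}(\mathbb{R}^d),\ \mathrm{lip}(\nabla u)\le1\Big\}.$$ *)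

(* Defs.v *)
From HB Require Import structures.
From mathcomp Require Import all_boot all_order all_algebra.
From mathcomp Require Import all_classical all_reals all_analysis.
Set Implicit Arguments.
Unset Strict Implicit.
Unset Printing Implicit Defensive.
Import Order.TTheory GRing.Theory Num.Theory.
Import numFieldNormedType.Exports.
Local Open Scope classical_set_scope.
Local Open Scope ring_scope.
Local Open Scope ereal_scope.

(* R^d with its Borel sigma-algebra. The library topology on row vectors is
   that of the sup norm, i.e. the Euclidean one. *)
Definition Rd (R : realType) (d : nat) : measurableType _ :=
  g_sigma_algebraType (@open 'rV[R]_d).

(* The library norm on 'rV[R]_d is the sup norm, so the Euclidean norm has to
   be introduced separately. *)
Definition enorm (R : realType) (d : nat) (x : 'rV[R]_d) : R :=
  Num.sqrt (\sum_(i < d) x 0%R i ^+ 2)%R.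

(* Two probabilities in MathComp-Analysis are functions on all sets; as measures
   they are compared on measurable sets only. *)
Definition same_measure d (T : measurableType d) (R : realType)
  (mu nu : set T -> \bar R) : Prop :=
  forall A : set T, measurable A -> mu A = nu A.

Section wasserstein_zolotarev.
Context (R : realType) (d : nat).
Implicit Types (mu nu : probability (Rd R d) R) (u : 'rV[R]_d -> R).

Definition P2 mu : Prop := \int[mu]_x (enorm x ^+ 2)%:E < +oo.

Definition barycentre mu : 'rV[R]_d :=
  (\row_(i < d) \int[mu]_x (x : 'rV[R]_d) 0 i)%R.

Definition var mu : R :=
  (\int[mu]_x (enorm ((x : 'rV[R]_d) - barycentre mu) ^+ 2))%R.

Definition stddev mu : R := Num.sqrt (var mu).

(* The product sigma-algebra on Rd R d * Rd R d is the Borel sigma-algebra of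
   R^d x R^d, since R^d is second countable. *)
Definition couplings mu nu : set (probability (Rd R d * Rd R d)%type R) :=
  [set gamma | same_measure (pushforward gamma fst) mu /\
               same_measure (pushforward gamma snd) nu].

Definition W2 mu nu : \bar R :=
  sqrte (ereal_inf
    [set \int[gamma]_z (enorm ((z.1 : 'rV[R]_d) - z.2) ^+ 2)%:E
       | gamma in couplings mu nu]).

Definition grad u (x : 'rV[R]_d) : 'rV[R]_d :=
  (\row_(i < d) 'D_(delta_mx 0 i) u x)%R.

Definition lip (F : 'rV[R]_d -> 'rV[R]_d) : \bar R :=
  ereal_sup [set (enorm (F p.1 - F p.2) / enorm (p.1 - p.2))%:E
               | p in [set p : 'rV[R]_d * 'rV[R]_d | p.1 <> p.2]].

Definition C11 u : Prop :=
  [/\ forall x, differentiable u x, continuous (grad u) & lip (grad u) < +oo].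

(* For mu and nu in P2 and u in C11, both integrals are finite because u grows
   at most quadratically. *)
Definition Z2 mu nu : \bar R :=
  ereal_sup [set \int[nu]_x (u x)%:E - \int[mu]_x (u x)%:E
               | u in [set u | C11 u /\ lip (grad u) <= 1]].

Definition dilation (m : 'rV[R]_d) (lambda : R) (x : Rd R d) : Rd R d :=
  (m + lambda *: ((x : 'rV[R]_d) - m))%R.

Definition ratios (a b : R) : set (\bar R) :=
  [set r | exists mu nu,
     [/\ P2 mu /\ P2 nu, (stddev mu <= a)%R /\ (stddev nu <= b)%R,
         ~ same_measure mu nu, barycentre mu = 0%R /\ barycentre nu = 0%R &
         r = Z2 mu nu / W2 mu nu]].

(* ereal_sup set0 is -oo, whereas here the supremum of the empty set is 0. *)
Definition h (a b : R) : \bar R :=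
  if ratios a b == set0 then 0 else ereal_sup (ratios a b).

End wasserstein_zolotarev.

Arguments h {R} d a b.

(* Main.v *)
Require Import Defs.
From HB Require Import structures.
From mathcomp Require Import all_boot all_order all_algebra.
From mathcomp Require Import all_classical all_reals all_analysis.
From mathcomp Require Import measurable_realfun ring lra.
Set Implicit Arguments.
Unset Strict Implicit.
Unset Printing Implicit Defensive.
Import Order.TTheory GRing.Theory Num.Theory.
Import numFieldNormedType.Exports.
Local Open Scope classical_set_scope.
Local Open Scope ring_scope.

(** Let [u] be [C11] with a 1-Lipschitz gradient and let [m] be the common
    barycentre.  Subtracting from [u] its first-order Taylor polynomial at [m]
    leaves the difference of the two integrals unchanged, because the barycentres
    agree, so one may assume [grad u m = 0], hence [|grad u z| <= |z - m|].
    Integrating [grad u] along the segment from [x] to [y] gives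
      [u y - u x <= 1/2 |y - x| (|x - m| + |y - m|)].
    Integrating against a coupling of cost [c] and applying Cauchy-Schwarz already
    yields the inequality, but loses the information that the equality case
    requires.  Cutting the segment at its midpoint and applying the estimate to
    each half ([C11_increment_mid]) gives the sharper
      [u y - u x <= 1/4 |y - x| (|x - m| + |y - m| + |(x - m) + (y - m)|)].
    By the parallelogram identity the mean square of [(x - m) + (y - m)] is
    [2 s^2 + 2 t^2 - c], where [s] and [t] are the standard deviations, so letting
    [c] tend to its infimum [W^2] gives ([Z2_le_refined])
      [Z2 <= 1/4 W (s + t + sqrt (2 s^2 + 2 t^2 - W^2))].
    The reverse triangle inequality in L2 says [|s - t| <= W], that is, the square
    root is at most [s + t]: this is the inequality of the theorem.

    Equality with [0 < W] forces the square root to equal [s + t], i.e.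
    [W = |s - t|].  Conversely, if [W <= |s - t|], the two quadratic functions
    [+- |x - m|^2 / 2] show that [Z2 >= 1/2 |s^2 - t^2| >= 1/2 (s + t) W].  So the
    equality case becomes a statement about [W] alone.  For measures that differ
    by a dilation the obvious coupling has cost [(s - t)^2].  In the other
    direction, with [lambda = t / s], every coupling of cost [c] satisfies
      [int |(y - m) - lambda (x - m)|^2 = lambda (c - (s - t)^2)],
    which is arbitrarily small for near-optimal couplings; and two laws that admit
    couplings of arbitrarily small cost coincide ([vanishing_cost_same_measure]).
    The degenerate cases are [W = 0] (take [lambda = 1]) and [s = 0] (then [mu] is
    the image of [nu] by the constant map, [lambda = 0]).

    For the optimality of the constant, the symmetric two-point measures of
    standard deviations [a'] and [b'] on a line satisfy [W = |a' - b'|], so their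
    ratio is exactly [1/2 (a' + b')] as soon as [a' <> b']; when [a = b] the
    supremum is approached by letting [a'] increase to [a]. *)

(** * Cauchy-Schwarz and the Euclidean norm *)

(** The discriminant argument behind Cauchy-Schwarz, stated for numbers so that
    it serves both for vectors and for integrals. *)
Lemma le_sqrt_discr (R : realType) (A B C : R) : 0 <= A -> 0 <= C ->
  (forall t, 0 <= A - 2 * t * B + t ^+ 2 * C) -> B <= Num.sqrt A * Num.sqrt C.
Proof.
move=> A0; rewrite le_eqVlt => /predU1P[<-|C0] H.
  rewrite sqrtr0 mulr0 leNgt; apply/negP => B0.
  have := H ((A + 1) / (2 * B)).
  have -> : 2 * ((A + 1) / (2 * B)) * B = A + 1 by field; rewrite gt_eqF.
  by rewrite mulr0; lra.
rewrite -sqrtrM// (le_trans (ler_norm B))// -sqrtr_sqr ler_wsqrtr//.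
have := H (B / C).
have -> : A - 2 * (B / C) * B + (B / C) ^+ 2 * C = (A * C - B ^+ 2) / C.
  by field; rewrite gt_eqF.
by rewrite pmulr_lge0 ?invr_gt0// subr_ge0.
Qed.

Section euclidean.
Context (R : realType) (d : nat).
Implicit Types (x y z m : 'rV[R]_d).

Definition dot x y : R := \sum_(i < d) x 0 i * y 0 i.

Lemma dotDl x y z : dot (x + y) z = dot x z + dot y z.
Proof. by rewrite -big_split; apply: eq_bigr => i _; rewrite mxE mulrDl. Qed.

Lemma dotC x y : dot x y = dot y x.
Proof. by apply: eq_bigr => i _; rewrite mulrC. Qed.

Lemma dotZl a x y : dot (a *: x) y = a * dot x y.
Proof. by rewrite mulr_sumr; apply: eq_bigr => i _; rewrite mxE mulrA. Qed.

Lemma dotNl x y : dot (- x) y = - dot x y.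
Proof. by rewrite -scaleN1r dotZl mulN1r. Qed.

Lemma dotDr x y z : dot x (y + z) = dot x y + dot x z.
Proof. by rewrite dotC dotDl !(dotC _ x). Qed.

Lemma dotZr a x y : dot x (a *: y) = a * dot x y.
Proof. by rewrite dotC dotZl dotC. Qed.

Lemma dotNr x y : dot x (- y) = - dot x y.
Proof. by rewrite dotC dotNl dotC. Qed.

Lemma dot_ge0 x : 0 <= dot x x.
Proof. by apply: sumr_ge0 => i _; rewrite -expr2 sqr_ge0. Qed.

Lemma enorm_ge0 x : 0 <= enorm x.
Proof. exact: sqrtr_ge0. Qed.

Lemma enormE x : enorm x = Num.sqrt (dot x x).
Proof. by congr Num.sqrt; apply: eq_bigr => i _; rewrite expr2. Qed.

Lemma sqr_enorm x : enorm x ^+ 2 = dot x x.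
Proof. by rewrite enormE sqr_sqrtr ?dot_ge0. Qed.

Lemma sqr_enormD x y : enorm (x + y) ^+ 2 = enorm x ^+ 2 + enorm y ^+ 2 + 2 * dot x y.
Proof. by rewrite !sqr_enorm !dotDl !dotDr (dotC y x); ring. Qed.

Lemma sqr_enormB x y : enorm (x - y) ^+ 2 = enorm x ^+ 2 + enorm y ^+ 2 - 2 * dot x y.
Proof. by rewrite sqr_enormD !sqr_enorm !(dotNl, dotNr) opprK mulrN. Qed.

Lemma enormZ a x : enorm (a *: x) = `|a| * enorm x.
Proof.
by rewrite !enormE dotZl dotZr mulrA -expr2 sqrtrM ?sqr_ge0// sqrtr_sqr.
Qed.

Lemma enormN x : enorm (- x) = enorm x.
Proof. by rewrite -scaleN1r enormZ normrN1 mul1r. Qed.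

Lemma enorm0 : enorm (0 : 'rV[R]_d) = 0.
Proof. by rewrite -(scale0r 0) enormZ normr0 mul0r. Qed.

Lemma enormBC x y : enorm (x - y) = enorm (y - x).
Proof. by rewrite -enormN opprB. Qed.

Lemma enorm_gt0 x : x <> 0 -> 0 < enorm x.
Proof.
move=> x0; rewrite enormE sqrtr_gt0 lt_neqAle dot_ge0 andbT.
apply/eqP => /esym/eqP; rewrite psumr_eq0 => [|i _]; last by rewrite -expr2 sqr_ge0.
move=> /allP H; apply: x0; apply/rowP => i; rewrite mxE.
by have := H i (mem_index_enum _); rewrite /= mulf_eq0 orbb => /eqP.
Qed.

Lemma dot_le x y : dot x y <= enorm x * enorm y.
Proof.
rewrite !enormE; apply: le_sqrt_discr => [||t]; rewrite ?dot_ge0//.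
suff -> : dot x x - 2 * t * dot x y + t ^+ 2 * dot y y = dot (x - t *: y) (x - t *: y).
  exact: dot_ge0.
by rewrite !(dotDl, dotDr, dotNl, dotNr, dotZl, dotZr) (dotC y x); ring.
Qed.

Lemma enormD x y : enorm (x + y) <= enorm x + enorm y.
Proof.
rewrite -(@ler_pXn2r _ 2)// ?nnegrE ?addr_ge0 ?enorm_ge0//.
by rewrite sqr_enormD; have := dot_le x y; nra.
Qed.

(** Balls of the topology are those of the sup norm; this comparison is what lets
    a small Euclidean cost move points only slightly. *)
Lemma norm_le_enorm x : `|x| <= enorm x.
Proof.
rewrite [leLHS]mx_normrE; apply/bigmax_leP; split=> [|[i j] _]; first exact: enorm_ge0.
rewrite /= -sqrtr_sqr ler_wsqrtr// (bigD1 j)//= ord1 lerDl.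
by apply: sumr_ge0 => k _; rewrite sqr_ge0.
Qed.

End euclidean.

(** * Increments of functions with a 1-Lipschitz gradient *)

Section C11_bounds.
Context (R : realType) (d : nat).
Implicit Types (x y z m v : 'rV[R]_d) (u : 'rV[R]_d -> R).

Lemma derive_grad u x v : differentiable u x -> 'D_v u x = dot (grad u x) v.
Proof.
move=> du; rewrite deriveE//.
rewrite [in LHS](row_sum_delta v) linear_sum; apply: eq_bigr => i _.
by rewrite linearZ/= mxE deriveE// mulrC.
Qed.

Lemma is_derive_line u x v (t : R) : differentiable u (x + t *: v) ->
  is_derive t (1 : R) (fun s : R => u (x + s *: v)) (dot (grad u (x + t *: v)) v).
Proof.
move=> du; pose l := cst x + ( *:%R ^~ v : R -> _).
have dl : is_diff t l ( *:%R ^~ v).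
  by have := is_diffD (is_diff_cst x t) (is_diff_scalel t v); rewrite add0r.
have du' : is_diff (l t) u ('d u (l t)) by exact: differentiableP.
have dul : is_diff t (u \o l) ('d u (l t) \o *:%R ^~ v) by exact: is_diff_comp.
have dulT : differentiable (u \o l) t by exact: ex_diff.
apply: DeriveDef; first exact/derivable1_diffP.
rewrite -[fun s => u _]/(u \o l) deriveE// diff_val/= scale1r.
by rewrite -derive_grad// deriveE.
Qed.

Lemma lip_le1 (F : 'rV[R]_d -> 'rV[R]_d) x y : (lip F <= 1)%E ->
  enorm (F x - F y) <= enorm (x - y).
Proof.
move=> lipF; have [->|/eqP xy] := eqVneq x y; first by rewrite !subrr.
have xy0 : 0 < enorm (x - y) by apply: enorm_gt0 => /eqP; rewrite subr_eq0 => /eqP.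
rewrite -[leRHS]mul1r -ler_pdivrMr//.
rewrite -lee_fin (le_trans _ lipF)//.
by apply: ereal_sup_ubound; exists (x, y).
Qed.

(** Along the segment, [|grad u - grad u m|] is at most the distance to [m],
    which is convex and so lies below its chord; the chord integrates to the mean
    of its end values.  Subtracting that integral from [u] turns the estimate
    into the mean value theorem. *)
Lemma C11_increment u m x y : C11 u -> (lip (grad u) <= 1)%E ->
  u y - u x - dot (grad u m) (y - x) <= 2^-1 * (enorm (y - x) * (enorm (x - m) + enorm (y - m))).
Proof.
move=> [du _ _] lipu.
set p := grad u m; set N := enorm (y - x); set a := enorm _; set b := enorm _.
pose phi := fun t : R =>
  u (x + t *: (y - x)) - (dot p (y - x) + N * a) * t - N * (b - a) / 2 * t ^+ 2.
have dphi (t : R) : is_derive t (1 : R) phi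
    (dot (grad u (x + t *: (y - x))) (y - x) - (dot p (y - x) + N * a) - N * (b - a) * t).
  have dut := is_derive_line (du (x + t *: (y - x))).
  rewrite (_ : phi = (fun s : R => u (x + s *: (y - x))) -
    (dot p (y - x) + N * a) *: (id : R -> R) - (N * (b - a) / 2) *: (id ^+ 2 : R -> R)); last first.
    by apply/funext => s.
  by apply: is_derive_eq; rewrite /GRing.scale/= expr1; field.
have cphi : {within `[0, 1], continuous phi}.
  by apply: derivable_within_continuous => t _; exact: ex_derive.
have [t] := MVT ltr01 (fun t _ => dphi t) cphi.
rewrite in_itv/= => /andP[t0 t1]; rewrite subr0 mulr1.
have -> : phi 1 - phi 0 = u y - u x - dot p (y - x) - N * a - N * (b - a) / 2.
  by rewrite /phi scale1r scale0r addr0 (addrC x) subrK; ring.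
move=> E.
suff: dot (grad u (x + t *: (y - x))) (y - x) - dot p (y - x) <= N * ((1 - t) * a + t * b).
  by move: E; lra.
rewrite -dotNl -dotDl (le_trans (dot_le _ _))// mulrC ler_wpM2l ?enorm_ge0//.
rewrite (le_trans (lip_le1 _ _ lipu))//.
have -> : x + t *: (y - x) - m = (1 - t) *: (x - m) + t *: (y - m).
  by apply/rowP => i; rewrite !mxE; ring.
rewrite (le_trans (enormD _ _))// !enormZ !ger0_norm//; lra.
Qed.

(** The loss in [C11_increment] is the gap between a convex function and its
    chord; one cut at the midpoint makes [|x - m + (y - m)|] appear, which detects
    whether [x - m] and [y - m] point in the same direction. *)
Lemma C11_increment_mid u m x y : C11 u -> (lip (grad u) <= 1)%E ->
  u y - u x - dot (grad u m) (y - x) <=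
  4^-1 * (enorm (y - x) * (enorm (x - m) + enorm (y - m) + enorm (x - m + (y - m)))).
Proof.
move=> Cu lu; pose z := 2^-1 *: (x + y).
have := C11_increment m x z Cu lu; have := C11_increment m z y Cu lu.
have -> : z - m = 2^-1 *: (x - m + (y - m)) by apply/rowP => i; rewrite !mxE; field.
have -> : y - z = 2^-1 *: (y - x) by apply/rowP => i; rewrite !mxE; field.
have -> : z - x = 2^-1 *: (y - x) by apply/rowP => i; rewrite !mxE; field.
rewrite !enormZ !dotZr ger0_norm//; lra.
Qed.

End C11_bounds.

(** * Measurability, square-integrable functions and laws *)

Section borel.
Context (R : realType) (d : nat).

Lemma measurable_open (A : set 'rV[R]_d) : open A -> measurable (A : set (Rd R d)).
Proof. by move=> oA; exact: sub_sigma_algebra. Qed.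

Lemma measurable_continuous (f : 'rV[R]_d -> R) :
  continuous f -> measurable_fun setT (f : Rd R d -> R).
Proof.
move=> /continuousP cf; apply: (measurability _ (RGenOpens.measurableE R)).
move=> _ [_ [x [y ->]] <-]; rewrite setTI.
by apply: measurable_open; apply: cf; exact: itv_open.
Qed.

Lemma measurable_continuous_Rd (f : 'rV[R]_d -> 'rV[R]_d) :
  continuous f -> measurable_fun setT (f : Rd R d -> Rd R d).
Proof.
move=> /continuousP cf; apply: (@measurability _ _ (Rd R d) (Rd R d) setT f (@open 'rV[R]_d)) => //.
by move=> _ [A oA <-]; rewrite setTI; apply: measurable_open; exact: cf.
Qed.

Lemma measurable_coord i : measurable_fun setT (fun x : Rd R d => (x : 'rV[R]_d) 0 i).
Proof. by apply: measurable_continuous => x; exact: coord_continuous. Qed.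

Lemma continuous_dilation (m : 'rV[R]_d) lambda :
  continuous (dilation m lambda : 'rV[R]_d -> 'rV[R]_d).
Proof.
rewrite (_ : dilation m lambda =
  (fun x : 'rV[R]_d => cst m x + (cst lambda x) *: (id x - cst m x)))//.
move=> x; apply: continuousD; first exact: cst_continuous.
apply: continuousZ; first exact: cst_continuous.
by apply: continuousB => //; exact: cst_continuous.
Qed.

Lemma measurable_dilation (m : 'rV[R]_d) lambda : measurable_fun setT (dilation m lambda).
Proof. apply: measurable_continuous_Rd; exact: continuous_dilation. Qed.

Lemma measurable_sqr_enorm d0 (T : measurableType d0) (X : T -> 'rV[R]_d) :
  (forall i, measurable_fun setT (fun w => X w 0 i)) ->
  measurable_fun setT (fun w => enorm (X w) ^+ 2).
Proof.
move=> mX; rewrite (_ : (fun w => _) = fun w => \sum_(i < d) X w 0 i * X w 0 i).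
  by apply: measurable_sum => i; exact: measurable_funM.
by apply/funext => w; rewrite sqr_enorm.
Qed.

Lemma measurable_cost :
  measurable_fun setT (fun z : Rd R d * Rd R d => enorm ((z.1 : 'rV[R]_d) - z.2) ^+ 2).
Proof.
apply: measurable_sqr_enorm => i.
rewrite (_ : (fun w => _) = fun z : Rd R d * Rd R d =>
  (z.1 : 'rV[R]_d) 0 i - (z.2 : 'rV[R]_d) 0 i).
  apply: measurable_funB.
    exact: (measurableT_comp (measurable_coord i) measurable_fst).
  exact: (measurableT_comp (measurable_coord i) measurable_snd).
by apply/funext => z; rewrite !mxE.
Qed.

End borel.

Section square_integrable.
Context d0 (T : measurableType d0) (R : realType) (P : probability T R).
Implicit Types f g : T -> R.

Lemma Lfun2P f : measurable_fun setT f ->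
  (\int[P]_w (f w ^+ 2)%:E < +oo)%E -> f \in Lfun P 2%:E.
Proof.
move=> mf fi; rewrite inE; apply/andP; split; rewrite inE//=.
rewrite /finite_norm unlock /Lnorm poweR_lty//.
apply: le_lt_trans fi; rewrite le_eqVlt; apply/orP; left; apply/eqP.
apply: eq_integral => w _ /=.
by rewrite powR_mulrn// real_normK// num_real.
Qed.

Lemma Lfun2_measurable f : f \in Lfun P 2%:E -> measurable_fun setT f.
Proof. by move=> /sub_Lfun_mfun; rewrite inE. Qed.

Lemma Lfun2D f g : f \in Lfun P 2%:E -> g \in Lfun P 2%:E ->
  (fun w => f w + g w) \in Lfun P 2%:E.
Proof. by move=> f2 g2; rewrite -[fun w => _]/(f + g) rpredD// lee1n. Qed.

Lemma Lfun2Z a f : f \in Lfun P 2%:E -> (fun w => a * f w) \in Lfun P 2%:E.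
Proof.
by move=> f2; rewrite (_ : (fun w => _) = a \o* f) ?Lfun_scale ?ler1n//;
  apply/funext => w /=; rewrite mulrC.
Qed.

Lemma Lfun2_integrable f : f \in Lfun P 2%:E -> P.-integrable setT (EFin \o f).
Proof.
by move=> f2; apply/Lfun1_integrable; apply: Lfun_subset12 => //; exact: fin_num_measure.
Qed.

Lemma Lfun2M_integrable f g : f \in Lfun P 2%:E -> g \in Lfun P 2%:E ->
  P.-integrable setT (EFin \o (fun w => f w * g w)).
Proof. by move=> f2 g2; apply/Lfun1_integrable; exact: Lfun2_mul_Lfun1. Qed.

Lemma integrableD_fun f g :
  P.-integrable setT (EFin \o f) -> P.-integrable setT (EFin \o g) ->
  P.-integrable setT (EFin \o (fun w => f w + g w)).
Proof.
by move=> fi gi; rewrite (_ : _ \o _ = (EFin \o f) \+ (EFin \o g))%E ?integrableD.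
Qed.

Lemma integrableZ_fun a f : P.-integrable setT (EFin \o f) ->
  P.-integrable setT (EFin \o (fun w => a * f w)).
Proof.
move=> fi; rewrite (_ : _ \o _ = (fun w => a%:E * (EFin \o f) w))%E; last by [].
exact: integrableZl.
Qed.

Lemma integrable_sum_fun n (f : 'I_n -> T -> R) :
  (forall i, P.-integrable setT (EFin \o f i)) ->
  P.-integrable setT (EFin \o (fun w => \sum_(i < n) f i w)).
Proof.
move=> fi; rewrite (_ : _ \o _ = fun w => (\sum_(i < n) (EFin \o f i) w)%E).
  by apply: integrable_sum => // i _.
by apply/funext => w /=; rewrite sumEFin.
Qed.

Lemma Rintegral_sum n (f : 'I_n -> T -> R) :
  (forall i, P.-integrable setT (EFin \o f i)) ->
  \int[P]_w (\sum_(i < n) f i w) = \sum_(i < n) \int[P]_w f i w.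
Proof.
elim: n f => [|n IH] f fi.
  rewrite big_ord0; under eq_Rintegral do rewrite big_ord0.
  by rewrite Rintegral_cst// mul0r.
rewrite big_ord_recl -IH//; under eq_Rintegral do rewrite big_ord_recl.
by rewrite RintegralD//; exact: integrable_sum_fun.
Qed.

Lemma EFin_Rintegral f : P.-integrable setT (EFin \o f) ->
  (\int[P]_w (f w)%:E)%E = (\int[P]_w f w)%:E.
Proof. by move=> fi; rewrite fineK//; exact: integrable_fin_num. Qed.

Lemma Cauchy_Schwarz_Rintegral f g : f \in Lfun P 2%:E -> g \in Lfun P 2%:E ->
  \int[P]_w (f w * g w) <=
  Num.sqrt (\int[P]_w (f w ^+ 2)) * Num.sqrt (\int[P]_w (g w ^+ 2)).
Proof.
move=> f2 g2; have fi := Lfun2_integrable_sqr f2; have gi := Lfun2_integrable_sqr g2.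
have fgi := Lfun2M_integrable f2 g2.
apply: le_sqrt_discr => [||t]; try by apply: Rintegral_ge0 => w _; rewrite sqr_ge0.
suff -> : \int[P]_w (f w ^+ 2) - 2 * t * \int[P]_w (f w * g w) +
    t ^+ 2 * \int[P]_w (g w ^+ 2) = \int[P]_w ((f w - t * g w) ^+ 2).
  by apply: Rintegral_ge0 => w _; rewrite sqr_ge0.
have fgi' := integrableZ_fun (- (2 * t)) fgi.
have gi' := integrableZ_fun (t ^+ 2) gi.
rewrite -mulNr -!RintegralZl// -RintegralD//.
rewrite -RintegralD//; last exact: integrableD_fun.
by apply: eq_Rintegral => w _; ring.
Qed.

End square_integrable.

Section law.
Context (R : realType) (d : nat) d0 (T : measurableType d0) (P : probability T R).
Implicit Types (X Y : T -> Rd R d) (mu nu : probability (Rd R d) R).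

(** Couplings, identity maps and explicit constructions are all treated as
    random vectors with prescribed laws.  The law is a bare set function because
    image measures appear as such in the theorem. *)
Definition has_law X (mu : set (Rd R d) -> \bar R) :=
  measurable_fun setT X /\ same_measure (pushforward P X) mu.

Lemma ge0_integral_law X mu (f : Rd R d -> \bar R) : has_law X mu ->
  measurable_fun setT f -> (forall x, 0 <= f x)%E ->
  (\int[mu]_x f x = \int[P]_w f (X w))%E.
Proof.
move=> [mX lX] mf f0.
transitivity (\int[pushforward P X]_x f x)%E.
  by apply: eq_measure_integral => // A mA _; exact/esym/lX.
by rewrite ge0_integral_pushforward.
Qed.

Lemma integral_law X mu (f : Rd R d -> \bar R) : has_law X mu ->
  measurable_fun setT f -> (\int[mu]_x f x = \int[P]_w f (X w))%E.
Proof.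
move=> lX mf; rewrite integralE [RHS]integralE; congr (_ - _)%E.
- rewrite (ge0_integral_law lX)//; last exact: measurable_funepos.
  by apply: eq_integral => w _; rewrite !funeposE.
- rewrite (ge0_integral_law lX)//; last exact: measurable_funeneg.
  by apply: eq_integral => w _; rewrite !funenegE.
Qed.

Lemma Rintegral_law X mu (f : Rd R d -> R) : has_law X mu ->
  measurable_fun setT f -> \int[mu]_x f x = \int[P]_w f (X w).
Proof. by move=> lX mf; congr fine; rewrite (integral_law lX)//; exact/measurable_EFinP. Qed.

(** The coupling is the law of the pair; every explicit upper bound on the distance
    comes from here. *)
Lemma couplings_law X Y mu nu : has_law X mu -> has_law Y nu ->
  exists2 gamma, couplings mu nu gamma &
    (\int[gamma]_z (enorm ((z.1 : 'rV[R]_d) - z.2) ^+ 2)%:E =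
     \int[P]_w (enorm ((X w : 'rV[R]_d) - Y w) ^+ 2)%:E)%E.
Proof.
move=> [mX lX] [mY lY].
have mXY : measurable_fun setT (fun w => (X w, Y w)) by exact: measurable_fun_pair.
pose XY : {mfun T >-> (Rd R d * Rd R d)%type} := HB.pack (fun w => (X w, Y w))
  (isMeasurableFun.Build _ _ _ _ _ mXY).
exists (distribution P XY).
  by split=> A mA; [exact: lX|exact: lY].
rewrite ge0_integral_distribution//; last by move=> z; rewrite lee_fin sqr_ge0.
by apply/measurable_EFinP; exact: measurable_cost.
Qed.

End law.

(** * Square-integrable random vectors *)

Section L2_vectors.
Context d0 (T : measurableType d0) (R : realType) (P : probability T R) (d : nat).
Implicit Types X Y : T -> 'rV[R]_d.

Definition L2 X := forall i, (fun w => X w 0 i) \in Lfun P 2%:E.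

Definition msq X : R := \int[P]_w (enorm (X w) ^+ 2).

Lemma L2_ext X Y : X =1 Y -> L2 X -> L2 Y.
Proof. by move=> /funext ->. Qed.

Lemma L2D X Y : L2 X -> L2 Y -> L2 (fun w => X w + Y w).
Proof.
move=> X2 Y2 i; rewrite (_ : (fun w => _) = fun w => X w 0 i + Y w 0 i) ?Lfun2D//.
by apply/funext => w; rewrite mxE.
Qed.

Lemma L2Z a X : L2 X -> L2 (fun w => a *: X w).
Proof.
move=> X2 i; rewrite (_ : (fun w => _) = fun w => a * X w 0 i) ?Lfun2Z//.
by apply/funext => w; rewrite mxE.
Qed.

Lemma L2_cst m : L2 (fun=> m).
Proof. by move=> i; exact: Lfun_cst. Qed.

Lemma L2B X Y : L2 X -> L2 Y -> L2 (fun w => X w - Y w).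
Proof.
move=> X2 Y2; apply: (@L2_ext (fun w => X w + (-1) *: Y w)).
  by move=> w; rewrite scaleN1r.
by apply: L2D => //; exact: L2Z.
Qed.

Lemma integrable_dot X Y : L2 X -> L2 Y ->
  P.-integrable setT (EFin \o (fun w => dot (X w) (Y w))).
Proof. by move=> X2 Y2; apply: integrable_sum_fun => i; exact: Lfun2M_integrable. Qed.

Lemma integrable_sqr_enorm X : L2 X ->
  P.-integrable setT (EFin \o (fun w => enorm (X w) ^+ 2)).
Proof. by move=> X2; under eq_fun do rewrite /= sqr_enorm; exact: integrable_dot. Qed.

Lemma measurable_enorm X : (forall i, measurable_fun setT (fun w => X w 0 i)) ->
  measurable_fun setT (fun w => enorm (X w)).
Proof.
move=> mX; rewrite (_ : (fun w => _) = (@Num.sqrt R) \o (fun w => enorm (X w) ^+ 2)).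
  apply: measurableT_comp; last exact: measurable_sqr_enorm.
  by apply: continuous_measurable_fun; exact: sqrt_continuous.
by apply/funext => w /=; rewrite sqrtr_sqr ger0_norm ?enorm_ge0.
Qed.

Lemma Lfun2_enorm X : L2 X -> (fun w => enorm (X w)) \in Lfun P 2%:E.
Proof.
move=> X2; apply: Lfun2P; last exact/integrable_lty/integrable_sqr_enorm.
by apply: measurable_enorm => i; exact: (Lfun2_measurable (X2 i)).
Qed.

Lemma msq_ge0 X : 0 <= msq X.
Proof. by apply: Rintegral_ge0 => w _; rewrite sqr_ge0. Qed.

Lemma EFin_msq X : L2 X -> (\int[P]_w (enorm (X w) ^+ 2)%:E)%E = (msq X)%:E.
Proof. by move=> X2; rewrite EFin_Rintegral//; exact: integrable_sqr_enorm. Qed.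

Lemma msqZ a X : L2 X -> msq (fun w => a *: X w) = a ^+ 2 * msq X.
Proof.
move=> X2; rewrite -RintegralZl//; last exact: integrable_sqr_enorm.
by apply: eq_Rintegral => w _; rewrite enormZ exprMn real_normK// num_real.
Qed.

Lemma msqB X Y : L2 X -> L2 Y ->
  msq (fun w => X w - Y w) = msq X + msq Y - 2 * \int[P]_w dot (X w) (Y w).
Proof.
move=> X2 Y2; have iX := integrable_sqr_enorm X2; have iY := integrable_sqr_enorm Y2.
have iXY := integrable_dot X2 Y2.
rewrite -mulNr -RintegralZl// -RintegralD// -RintegralD//.
- by apply: eq_Rintegral => w _; rewrite sqr_enormB mulNr.
- exact: integrableD_fun.
- exact: integrableZ_fun.
Qed.

(** The parallelogram identity, which converts the cost of a coupling into the mean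
    square of the sum. *)
Lemma msqD X Y : L2 X -> L2 Y ->
  msq (fun w => X w + Y w) = 2 * msq X + 2 * msq Y - msq (fun w => X w - Y w).
Proof.
move=> X2 Y2; have iX := integrable_sqr_enorm X2; have iY := integrable_sqr_enorm Y2.
have iXY := integrable_sqr_enorm (L2B X2 Y2).
have iX' := integrableZ_fun 2 iX; have iY' := integrableZ_fun 2 iY.
rewrite -!RintegralZl// -RintegralD// -RintegralB//; last exact: integrableD_fun.
by apply: eq_Rintegral => w _; rewrite sqr_enormB sqr_enormD; ring.
Qed.

Lemma Rintegral_dot_le X Y : L2 X -> L2 Y ->
  \int[P]_w dot (X w) (Y w) <= Num.sqrt (msq X) * Num.sqrt (msq Y).
Proof.
move=> X2 Y2; have nX := Lfun2_enorm X2; have nY := Lfun2_enorm Y2.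
apply: le_trans (Cauchy_Schwarz_Rintegral nX nY).
apply: le_Rintegral => //; [exact: integrable_dot|exact: Lfun2M_integrable|].
by move=> w _; exact: dot_le.
Qed.

Lemma Rintegral_enormM_le X Y : L2 X -> L2 Y ->
  \int[P]_w (enorm (X w) * enorm (Y w)) <= Num.sqrt (msq X) * Num.sqrt (msq Y).
Proof.
move=> X2 Y2; exact: Cauchy_Schwarz_Rintegral (Lfun2_enorm X2) (Lfun2_enorm Y2).
Qed.

Lemma Rintegral_enormM_sum_le A X Y Z : L2 A -> L2 X -> L2 Y -> L2 Z ->
  P.-integrable setT (EFin \o
    (fun w => enorm (A w) * (enorm (X w) + enorm (Y w) + enorm (Z w)))) /\
  \int[P]_w (enorm (A w) * (enorm (X w) + enorm (Y w) + enorm (Z w))) <=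
    Num.sqrt (msq A) * (Num.sqrt (msq X) + Num.sqrt (msq Y) + Num.sqrt (msq Z)).
Proof.
move=> A2 X2 Y2 Z2.
have CS W : L2 W -> P.-integrable setT (EFin \o (fun w => enorm (A w) * enorm (W w))).
  by move=> W2; exact: Lfun2M_integrable (Lfun2_enorm A2) (Lfun2_enorm W2).
have iX := CS _ X2; have iY := CS _ Y2; have iZ := CS _ Z2.
have iXY := integrableD_fun iX iY.
have -> : (fun w => enorm (A w) * (enorm (X w) + enorm (Y w) + enorm (Z w))) = fun w =>
    enorm (A w) * enorm (X w) + enorm (A w) * enorm (Y w) + enorm (A w) * enorm (Z w).
  by apply/funext => w; rewrite !mulrDr.
split; first exact: integrableD_fun.
rewrite RintegralD// RintegralD// !mulrDr.
apply: lerD; first apply: lerD.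
- exact: Rintegral_enormM_le.
- exact: Rintegral_enormM_le.
- exact: Rintegral_enormM_le.
Qed.

(** The reverse triangle inequality in L2, the source of every lower bound on costs. *)
Lemma sqr_stddevB_le_msq X Y : L2 X -> L2 Y ->
  (Num.sqrt (msq X) - Num.sqrt (msq Y)) ^+ 2 <= msq (fun w => X w - Y w).
Proof.
move=> X2 Y2; have := Rintegral_dot_le X2 Y2.
rewrite (msqB X2 Y2) sqrrB (sqr_sqrtr (msq_ge0 X)) (sqr_sqrtr (msq_ge0 Y)).
by set I := Rintegral _ _ _; rewrite mulr2n; lra.
Qed.

End L2_vectors.

Section law_moments.
Context (R : realType) (d : nat) d0 (T : measurableType d0) (P : probability T R).
Implicit Types (X Y : T -> Rd R d) (mu nu : probability (Rd R d) R).

Lemma measurable_coord_law X i : measurable_fun setT X ->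
  measurable_fun setT (fun w => (X w : 'rV[R]_d) 0 i).
Proof. by move=> mX; exact: (measurableT_comp (measurable_coord i) mX). Qed.

Lemma measurable_enorm_shift (m : 'rV[R]_d) :
  measurable_fun setT (fun x : Rd R d => enorm ((x : 'rV[R]_d) - m) ^+ 2).
Proof.
apply: measurable_sqr_enorm => i.
rewrite (_ : (fun _ => _) = fun x : Rd R d => (x : 'rV[R]_d) 0 i - m 0 i).
  by apply: measurable_funB => //; exact: measurable_coord.
by apply/funext => x; rewrite !mxE.
Qed.

Lemma L2_of_lty X : measurable_fun setT X ->
  (\int[P]_w (enorm (X w) ^+ 2)%:E < +oo)%E -> L2 P X.
Proof.
move=> mX iX i; apply: Lfun2P; first exact: measurable_coord_law.
apply: le_lt_trans iX; apply: ge0_le_integral => //.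
- by move=> w _; rewrite lee_fin sqr_ge0.
- by apply/measurable_EFinP/measurable_funX; exact: measurable_coord_law.
- apply/measurable_EFinP; apply: measurable_sqr_enorm => j; exact: measurable_coord_law.
- move=> w _; rewrite lee_fin sqr_enorm /dot (bigD1 i)//= expr2 lerDl.
  by apply: sumr_ge0 => j _; rewrite -expr2 sqr_ge0.
Qed.

Lemma law_L2 X mu : has_law P X mu -> P2 mu -> L2 P X.
Proof.
move=> lX; rewrite /P2 (ge0_integral_law lX) => [|/=|x]; last by rewrite lee_fin sqr_ge0.
  by apply: L2_of_lty; case: lX.
apply/measurable_EFinP; have := measurable_enorm_shift 0.
by under eq_fun do rewrite subr0.
Qed.

Lemma law_P2 X mu : has_law P X mu -> L2 P X -> P2 mu.
Proof.
move=> lX X2; rewrite /P2 (ge0_integral_law lX) => [|/=|x].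
- by rewrite EFin_msq ?ltry.
- apply/measurable_EFinP; have := measurable_enorm_shift 0.
  by under eq_fun do rewrite subr0.
- by rewrite lee_fin sqr_ge0.
Qed.

Lemma law_barycentre X mu : has_law P X mu ->
  barycentre mu = \row_i \int[P]_w (X w : 'rV[R]_d) 0 i.
Proof.
move=> lX; apply/rowP => i; rewrite !mxE (Rintegral_law lX)//.
exact: measurable_coord.
Qed.

Lemma law_var X mu : has_law P X mu ->
  var mu = msq P (fun w => (X w : 'rV[R]_d) - barycentre mu).
Proof.
move=> lX; rewrite /var (Rintegral_law lX)//.
exact: measurable_enorm_shift.
Qed.

Lemma Rintegral_dot_cst p (Z : T -> 'rV[R]_d) : L2 P Z ->
  \int[P]_w dot p (Z w) = dot p (\row_i \int[P]_w Z w 0 i).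
Proof.
move=> ZL2; rewrite Rintegral_sum => [|i].
  by apply: eq_bigr => i _; rewrite mxE RintegralZl//; exact: Lfun2_integrable.
exact/integrableZ_fun/Lfun2_integrable.
Qed.

End law_moments.

(** * Testing a coupling against one function *)

Section increment.
Context (R : realType) (d : nat) d0 (T : measurableType d0) (P : probability T R).
Implicit Types (X Y : T -> Rd R d) (mu nu : probability (Rd R d) R) (u : 'rV[R]_d -> R).

Lemma integrable_C11 u X : C11 u -> (lip (grad u) <= 1)%E ->
  measurable_fun setT X -> L2 P X -> P.-integrable setT (EFin \o (fun w => u (X w))).
Proof.
move=> Cu lu mX X2.
have [du _ _] := Cu.
have muX : measurable_fun setT (fun w => u (X w)).
  apply: measurableT_comp mX; apply: measurable_continuous => x.
  exact: differentiable_continuous.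
have iq := integrable_sqr_enorm X2.
have ip := integrable_dot (L2_cst P (grad u 0)) X2.
have ic : P.-integrable setT (EFin \o cst (u 0)) by exact: finite_measure_integrable_cst.
have mr : measurable_fun setT (fun w => u (X w) - u 0 - dot (grad u 0) (X w)).
  apply: measurable_funB; first exact: measurable_funB.
  by apply/measurable_EFinP; exact: measurable_int ip.
have ir : P.-integrable setT (EFin \o (fun w => u (X w) - u 0 - dot (grad u 0) (X w))).
  apply: (le_integrable _ _ _ iq) => //; first exact/measurable_EFinP.
  move=> w _ /=; rewrite lee_fin (ger0_norm (sqr_ge0 _)).
  have := C11_increment 0 0 (X w) Cu lu; have := C11_increment 0 (X w) 0 Cu lu.
  rewrite !subr0 sub0r enormN enorm0 dotNr => h1 h2.
  have := sqr_ge0 (enorm (X w)); rewrite ler_norml expr2.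
  by move: h1 h2; lra.
rewrite (_ : (fun w => u (X w)) = (fun w =>
   (u (X w) - u 0 - dot (grad u 0) (X w)) + (cst (u 0) w + dot (grad u 0) (X w)))); last first.
  by apply/funext => w /=; ring.
by apply: integrableD_fun => //; exact: integrableD_fun.
Qed.

(** Integrated form of [C11_increment_mid] with the barycentre as base point: there
    the linear term integrates to zero, and the three norms become the two standard
    deviations and, by [msqD], the square root. *)
Lemma increment_law X Y mu nu u : has_law P X mu -> has_law P Y nu ->
  P2 mu -> P2 nu -> barycentre mu = barycentre nu ->
  C11 u -> (lip (grad u) <= 1)%E ->
  (\int[nu]_x (u x)%:E - \int[mu]_x (u x)%:E <=
   (4^-1 * (Num.sqrt (msq P (fun w => (X w : 'rV[R]_d) - Y w)) *
     (stddev mu + stddev nu +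
      Num.sqrt (2 * stddev mu ^+ 2 + 2 * stddev nu ^+ 2 -
                msq P (fun w => (X w : 'rV[R]_d) - Y w)))))%:E)%E.
Proof.
move=> lX lY P2mu P2nu bary Cu lu.
set c := msq P _; set s := stddev mu; set t := stddev nu.
have X2 := law_L2 lX P2mu; have Y2 := law_L2 lY P2nu.
have [mX _] := lX; have [mY _] := lY.
have [du _ _] := Cu.
have measu : measurable_fun setT (u : Rd R d -> R).
  by apply: measurable_continuous => x; exact: differentiable_continuous.
have iX := integrable_C11 Cu lu mX X2; have iY := integrable_C11 Cu lu mY Y2.
rewrite (integral_law lX); last exact/measurable_EFinP.
rewrite (integral_law lY); last exact/measurable_EFinP.
rewrite !EFin_Rintegral// -EFinB lee_fin -RintegralB//.
set m := barycentre mu; set p := grad u m.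
have X'2 := L2B X2 (L2_cst P m); have Y'2 := L2B Y2 (L2_cst P m).
have D2 := L2B Y2 X2.
have ip := integrable_dot (L2_cst P p) D2.
have iYX : P.-integrable setT (EFin \o (fun w => u (Y w) - u (X w))).
  rewrite (_ : (fun w => _) = fun w => u (Y w) + (-1) * u (X w)); last first.
    by apply/funext => w; rewrite mulN1r.
  exact: integrableD_fun iY (integrableZ_fun (-1) iX).
(* Here equality of the barycentres removes the linear part. *)
have p0 : \int[P]_w dot p ((Y w : 'rV[R]_d) - X w) = 0.
  rewrite (Rintegral_dot_cst p D2) (_ : \row__ _ = 0); first by rewrite -(scale0r 0) dotZr mul0r.
  apply/rowP => i; rewrite !mxE.
  under eq_Rintegral do rewrite !mxE.
  rewrite RintegralB//; [|exact: Lfun2_integrable|exact: Lfun2_integrable].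
  have /rowP/(_ i) := bary; rewrite (law_barycentre lX) (law_barycentre lY) !mxE => ->.
  by rewrite subrr.
have [iB leB] := Rintegral_enormM_sum_le D2 X'2 Y'2 (L2D X'2 Y'2).
rewrite -[leLHS]subr0 -p0 -(RintegralB measurableT iYX ip).
have cE : msq P (fun w => (Y w : 'rV[R]_d) - X w) = c.
  by apply: eq_Rintegral => w _; rewrite enormBC.
have sE : Num.sqrt (msq P (fun w => (X w : 'rV[R]_d) - m)) = s by rewrite -(law_var lX).
have tE : Num.sqrt (msq P (fun w => (Y w : 'rV[R]_d) - m)) = t.
  by rewrite /t /stddev (law_var lY) -bary.
have sumE : msq P (fun w => ((X w : 'rV[R]_d) - m) + ((Y w : 'rV[R]_d) - m)) =
    2 * s ^+ 2 + 2 * t ^+ 2 - c.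
  rewrite (msqD X'2 Y'2) -sE -tE (sqr_sqrtr (msq_ge0 P _)) (sqr_sqrtr (msq_ge0 P _)).
  congr (_ - _); apply: eq_Rintegral => w _; congr (enorm _ ^+ 2).
  by rewrite opprB addrA subrK.
rewrite cE sE tE sumE in leB.
apply: le_trans (ler_wpM2l _ leB) => //.
rewrite -(RintegralZl _ measurableT iB).
apply: (le_Rintegral measurableT _ (integrableZ_fun _ iB)).
  rewrite (_ : (fun w => _) =
    fun w => u (Y w) - u (X w) + (-1) * dot p ((Y w : 'rV[R]_d) - X w)); last first.
    by apply/funext => w; rewrite mulN1r.
  exact: integrableD_fun iYX (integrableZ_fun (-1) ip).
by move=> w _; exact: C11_increment_mid.
Qed.

End increment.

(** * Laws at zero distance coincide *)

Section vanishing_cost.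
Context (R : realType) (d : nat) d0 (T : measurableType d0).
Implicit Types (X Y : T -> Rd R d) (mu nu : probability (Rd R d) R).

(** [X] and [Y] stay fixed while the probability varies, so that the same notion
    applies to a coupling and to its images by dilations. *)
Definition vanishing_cost X Y mu nu := forall e : R, 0 < e ->
  exists P : probability T R, [/\ has_law P X mu, has_law P Y nu &
    (\int[P]_w (enorm ((X w : 'rV[R]_d) - Y w) ^+ 2)%:E < e%:E)%E].

Lemma vanishing_costC X Y mu nu : vanishing_cost X Y mu nu -> vanishing_cost Y X nu mu.
Proof.
move=> H e /H[P [lX lY XYe]]; exists P; split; [exact: lY|exact: lX|].
by under eq_integral do rewrite enormBC.
Qed.

Definition thickening (F : set 'rV[R]_d) n := \bigcup_(x in F) ball x (n.+1%:R^-1 : R).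

Lemma open_thickening F n : open (thickening F n).
Proof. by apply: bigcup_open => x _; exact: ball_open. Qed.

Lemma bigcap_thickening F : closed F -> \bigcap_n thickening F n = F.
Proof.
move=> cF; apply/seteqP; split=> [x Fx|x Fx n _]; last first.
  by exists x => //; exact: ballxx.
rewrite [X in X x](closure_id F).1// => B /nbhs_ballP[e /= e0 xeB].
have [n ne] : exists n, n.+1%:R^-1 < e.
  by have [n _ H] := near_infty_natSinv_lt (PosNum e0); exists n; exact: (H n (leqnn n)).
have [y Fy yx] := Fx n I; exists y; split => //; apply: xeB.
by apply: ball_sym; exact: le_ball (ltW ne) _ yx.
Qed.

(** If [X] is in [F] and [Y] is outside the thickening, the two are at distance at
    least [1 / (n + 1)], which has small probability by Markov's inequality. *)
Lemma vanishing_cost_le_thickening X Y mu nu F n : vanishing_cost X Y mu nu ->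
  closed F -> (mu F <= nu (thickening F n))%E.
Proof.
move=> H cF; set V := thickening F n.
have mF : measurable (F : set (Rd R d)).
  by rewrite -[F]setCK; apply: measurableC; apply: measurable_open; exact: closed_openC.
have mV : measurable (V : set (Rd R d)) by apply: measurable_open; exact: open_thickening.
apply/lee_addgt0Pr => e e0.
have n0 : (0 : R) < n.+1%:R ^+ 2 by rewrite exprn_gt0.
have [P [[mX lX] [mY lY] XYe]] := H (e / n.+1%:R ^+ 2) (divr_gt0 e0 n0).
have mXF : measurable (X @^-1` F) by rewrite -[X in measurable X]setTI; exact: mX.
have mYV : measurable (Y @^-1` V) by rewrite -[X in measurable X]setTI; exact: mY.
have mc : measurable_fun setT (fun w => enorm ((X w : 'rV[R]_d) - Y w) ^+ 2).
  exact: (measurableT_comp (@measurable_cost R d) (measurable_fun_pair mX mY)).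
rewrite -lX// -lY// /pushforward.
have -> : P (X @^-1` F) = (\int[P]_w (\1_(X @^-1` F) w)%:E)%E by rewrite integral_indic// setIT.
have -> : P (Y @^-1` V) = (\int[P]_w (\1_(Y @^-1` V) w)%:E)%E by rewrite integral_indic// setIT.
apply: (@le_trans _ _ (\int[P]_w ((\1_(Y @^-1` V) w)%:E +
    (n.+1%:R ^+ 2)%:E * (enorm ((X w : 'rV[R]_d) - Y w) ^+ 2)%:E))%E).
  apply: ge0_le_integral => //=.
  - by apply/measurable_EFinP; exact: measurable_indic.
  - apply: emeasurable_funD; first by apply/measurable_EFinP; exact: measurable_indic.
    by apply/measurable_EFinP; apply: measurable_funM.
  - move=> w _; rewrite -EFinM -EFinD lee_fin !indicE.
    have [wF|wF] := boolP (w \in X @^-1` F); last first.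
      by rewrite addr_ge0// ?ler0n// mulr_ge0 ?sqr_ge0.
    have [wV|wV] := boolP (w \in Y @^-1` V).
      by rewrite lerDl mulr_ge0 ?sqr_ge0.
    rewrite add0r -exprMn exprn_ege1// leNgt; apply/negP => XYn.
    move: wV; rewrite notin_setE; apply; exists (X w); first by move: wF; rewrite inE.
    rewrite -ball_normE/= (le_lt_trans (norm_le_enorm _))//.
    by rewrite -[ltRHS]mul1r ltr_pdivlMr// mulrC.
rewrite ge0_integralD//; first last.
- by apply/measurable_EFinP; apply: measurable_funM.
- by move=> w _; rewrite -EFinM lee_fin mulr_ge0 ?sqr_ge0.
- by apply/measurable_EFinP; exact: measurable_indic.
rewrite leeD2l// ge0_integralZl_EFin//; first last.
- exact/measurable_EFinP.
- by move=> w _; rewrite lee_fin sqr_ge0.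
by rewrite -lee_pdivlMl// -EFinM mulrC ltW.
Qed.

Lemma vanishing_cost_le X Y mu nu F : vanishing_cost X Y mu nu ->
  closed F -> (mu F <= nu F)%E.
Proof.
move=> H cF.
have mV n : measurable (thickening F n : set (Rd R d)).
  by apply: measurable_open; exact: open_thickening.
have cvgV : nu (thickening F n) @[n --> \oo] --> nu F.
  rewrite -[in X in _ --> X](bigcap_thickening cF).
  apply: nonincreasing_cvg_mu => //.
  - by rewrite -ge0_fin_numE// fin_num_measure.
  - exact: bigcapT_measurable.
  - move=> i j ij; apply/subsetPset => y [x Fx xy]; exists x => //.
    by apply: le_ball xy; rewrite lef_pV2 ?posrE// ler_nat.
rewrite -(cvg_lim _ cvgV)//; apply: lime_ge; first by apply/cvg_ex; exists (nu F).
by apply: nearW => n; exact: vanishing_cost_le_thickening H cF.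
Qed.

(** The two laws agree on closed sets by symmetry, hence on open sets, which form
    a generating pi-system. *)
Lemma vanishing_cost_same_measure X Y mu nu : vanishing_cost X Y mu nu -> same_measure mu nu.
Proof.
move=> H.
have HF F : closed F -> mu F = nu F.
  move=> cF; apply/eqP; rewrite eq_le (vanishing_cost_le H cF).
  exact: vanishing_cost_le (vanishing_costC H) cF.
apply: (@g_sigma_algebra_measure_unique _ R (Rd R d) (@open 'rV[R]_d) _ (fun=> setT)).
- by move=> A oA; exact: measurable_open.
- by move=> _; exact: openT.
- by rewrite bigcup_const//; exists 0%N.
- by move=> A B; exact: openI.
- move=> A oA; have mA := measurable_open oA.
  have E (Q : probability (Rd R d) R) : (Q A = 1 - Q (~` A))%E.
    by rewrite -probability_setC ?setCK//; exact: measurableC.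
  have := HF _ (open_closedC oA) => HA.
  by apply: (etrans (E mu)); rewrite HA; exact: (esym (E nu)).
- by move=> _; rewrite -ge0_fin_numE// fin_num_measure.
Qed.

End vanishing_cost.

Section product_marginals.
Context d1 d2 (T1 : measurableType d1) (T2 : measurableType d2) (R : realType).
Context (Q1 : probability T1 R) (Q2 : probability T2 R).

Lemma product_marginal1 A : measurable A -> pushforward (Q1 \x Q2)%E fst A = Q1 A.
Proof.
move=> mA; rewrite /pushforward (_ : fst @^-1` A = A `*` setT).
  by rewrite product_measure1E// [X in (_ * X)%E](probability_setT Q2) mule1.
by apply/seteqP; split => // -[x y] [].
Qed.

Lemma product_marginal2 A : measurable A -> pushforward (Q1 \x Q2)%E snd A = Q2 A.
Proof.
move=> mA; rewrite /pushforward (_ : snd @^-1` A = setT `*` A).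
  by rewrite product_measure1E// [X in (X * _)%E](probability_setT Q1) mul1e.
by apply/seteqP; split => // -[x y] [].
Qed.

End product_marginals.

(** * The Wasserstein distance and the refined upper bound *)

Section wasserstein.
Context (R : realType) (d : nat).
Implicit Types (mu nu : probability (Rd R d) R).

Definition cost (gamma : probability (Rd R d * Rd R d)%type R) : R :=
  msq gamma (fun z => (z.1 : 'rV[R]_d) - z.2).

Lemma stddev_ge0 mu : 0 <= stddev mu.
Proof. exact: sqrtr_ge0. Qed.

Lemma sqr_stddev mu : stddev mu ^+ 2 = var mu.
Proof. by rewrite sqr_sqrtr//; apply: Rintegral_ge0 => x _; rewrite sqr_ge0. Qed.

Lemma couplings_has_law mu nu gamma : couplings mu nu gamma ->
  has_law gamma fst mu /\ has_law gamma snd nu.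
Proof. by move=> [g1 g2]; split; split. Qed.

Lemma coupling_costE mu nu gamma : P2 mu -> P2 nu -> couplings mu nu gamma ->
  (\int[gamma]_z (enorm ((z.1 : 'rV[R]_d) - z.2) ^+ 2)%:E)%E = (cost gamma)%:E.
Proof.
move=> Pmu Pnu /couplings_has_law[l1 l2]; rewrite EFin_msq//.
by apply: L2B; [exact: law_L2 l1 Pmu|exact: law_L2 l2 Pnu].
Qed.

Lemma exists_coupling mu nu : exists gamma, couplings mu nu gamma.
Proof.
exists (mu \x nu)%E.
by split=> A mA; [exact: product_marginal1|exact: product_marginal2].
Qed.

(** The real number [W] is the distance; couplings whose cost is arbitrarily close
    to [W ^+ 2] take the place of an optimal one. *)
Lemma W2P mu nu : P2 mu -> P2 nu -> exists W : R,
  [/\ 0 <= W, W2 mu nu = W%:E,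
      forall gamma, couplings mu nu gamma -> W ^+ 2 <= cost gamma &
      forall e, 0 < e -> exists2 gamma, couplings mu nu gamma & cost gamma < W ^+ 2 + e].
Proof.
move=> Pmu Pnu; rewrite /W2; set S := [set _ | _ in _].
have S0 : lbound S 0%E.
  by move=> _ [g _ <-]; apply: integral_ge0 => z _; rewrite lee_fin sqr_ge0.
have I0 : (0 <= ereal_inf S)%E by exact: le_ereal_inf_tmp.
have If : ereal_inf S \is a fin_num.
  rewrite ge0_fin_numE//.
  have [g cg] := exists_coupling mu nu.
  have Sp : S (cost g)%:E by exists g => //; exact: (coupling_costE Pmu Pnu cg).
  exact: le_lt_trans (ereal_inf_lbound Sp) (ltry _).
move: I0; rewrite -(fineK If) lee_fin; set r := fine _ => r0.
exists (Num.sqrt r); rewrite sqr_sqrtr// sqrtr_ge0; split=> //.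
- move=> g cg; rewrite -lee_fin -(coupling_costE Pmu Pnu cg) fineK//.
  by apply: ereal_inf_lbound; exists g.
- move=> e e0; have [_ [g cg <-]] := lb_ereal_inf_adherent e0 If.
  by rewrite (coupling_costE Pmu Pnu cg) -(fineK If) -EFinD lte_fin => ?; exists g.
Qed.

Lemma sqr_stddevB_le_cost mu nu gamma : P2 mu -> P2 nu -> barycentre mu = barycentre nu ->
  couplings mu nu gamma -> (stddev mu - stddev nu) ^+ 2 <= cost gamma.
Proof.
move=> Pmu Pnu bary /couplings_has_law[l1 l2].
have C (m : 'rV[R]_d) : L2 gamma (fun=> m) by exact: L2_cst.
have X2 := L2B (law_L2 l1 Pmu) (C (barycentre mu)).
have Y2 := L2B (law_L2 l2 Pnu) (C (barycentre nu)).
rewrite /stddev (law_var l1) (law_var l2).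
apply: (le_trans (sqr_stddevB_le_msq X2 Y2)); rewrite le_eqVlt; apply/orP; left; apply/eqP.
by apply: eq_Rintegral => z _; rewrite bary opprB addrA subrK.
Qed.

(** Ensures that the radicand in [refined_bound] is nonnegative. *)
Lemma cost_le_sqr_stddev mu nu gamma : P2 mu -> P2 nu -> barycentre mu = barycentre nu ->
  couplings mu nu gamma -> cost gamma <= 2 * stddev mu ^+ 2 + 2 * stddev nu ^+ 2.
Proof.
move=> Pmu Pnu bary /couplings_has_law[l1 l2].
have C (m : 'rV[R]_d) : L2 gamma (fun=> m) by exact: L2_cst.
have X2 := L2B (law_L2 l1 Pmu) (C (barycentre mu)).
have Y2 := L2B (law_L2 l2 Pnu) (C (barycentre nu)).
rewrite !sqr_stddev (law_var l1) (law_var l2).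
have := msq_ge0 gamma (fun z =>
  ((z.1 : 'rV[R]_d) - barycentre mu) + ((z.2 : 'rV[R]_d) - barycentre nu)).
rewrite msqD// subr_ge0; apply: le_trans; rewrite le_eqVlt; apply/orP; left; apply/eqP.
by apply: eq_Rintegral => z _; rewrite bary opprB addrA subrK.
Qed.

Lemma W2_le_cost d0 (T : measurableType d0) (P : probability T R)
    (X Y : T -> Rd R d) mu nu (W : R) :
  P2 mu -> P2 nu -> has_law P X mu -> has_law P Y nu -> 0 <= W -> W2 mu nu = W%:E ->
  W ^+ 2 <= msq P (fun w => (X w : 'rV[R]_d) - Y w).
Proof.
move=> Pmu Pnu lX lY W0 WE; have [V [V0 VE Vle _]] := W2P Pmu Pnu.
have [g cg gE] := couplings_law lX lY.
have -> : W = V by apply/EFin_inj; rewrite -WE VE.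
rewrite (le_trans (Vle _ cg))// -lee_fin -(coupling_costE Pmu Pnu cg) gE EFin_msq//.
by apply: L2B; [exact: law_L2 lX Pmu|exact: law_L2 lY Pnu].
Qed.

(** The midpoint estimate in terms of the standard deviations [s], [t] and the
    distance [W]; at [W = `|s - t|] it agrees with [1 / 2 * (s + t) * W]. *)
Definition refined_bound (s t W : R) : R :=
  4^-1 * (W * (s + t + Num.sqrt (2 * s ^+ 2 + 2 * t ^+ 2 - W ^+ 2))).

(** For a coupling of cost [c >= W ^+ 2] the term under the second square root of
    [increment_law] is at most its value at [W ^+ 2], so only the first factor has
    to be passed to the limit. *)
Lemma Z2_le_refined mu nu (W : R) : P2 mu -> P2 nu -> barycentre mu = barycentre nu ->
  0 <= W -> W2 mu nu = W%:E ->
  (Z2 mu nu <= (refined_bound (stddev mu) (stddev nu) W)%:E)%E.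
Proof.
move=> Pmu Pnu bary W0 WE; have [V [_ VE Vle Vadh]] := W2P Pmu Pnu.
have VW : V = W by apply/EFin_inj; rewrite -WE VE.
rewrite VW in Vle Vadh.
apply: ge_ereal_sup => _ [u [Cu lu] <-].
rewrite /refined_bound; set s := stddev mu; set t := stddev nu.
set K := s + t + _.
have K0 : 0 <= K by rewrite !addr_ge0 ?sqrtr_ge0.
apply/lee_addgt0Pr => e e0.
(* An excess of dl ^+ 2 in the cost moves its square root by at most dl, and dl is
   small enough for dl * K / 4 to be at most e. *)
pose dl := 4 * e / (K + 1).
have dl0 : 0 < dl by rewrite divr_gt0 ?mulr_gt0// ltr_wpDl.
have [g cg gW] := Vadh _ (exprn_gt0 2 dl0).
have Wg := Vle _ cg.
have [l1 l2] := couplings_has_law cg.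
apply: (le_trans (increment_law l1 l2 Pmu Pnu bary Cu lu)).
rewrite -EFinD lee_fin -/(cost g) -/s -/t.
apply: (@le_trans _ _ (4^-1 * ((W + dl) * K))).
  rewrite ler_wpM2l// ler_pM ?sqrtr_ge0//.
  - by rewrite !addr_ge0 ?sqrtr_ge0.
  - rewrite -[leRHS]ger0_norm ?addr_ge0 ?(ltW dl0)// -sqrtr_sqr ler_wsqrtr//.
    have := mulr_ge0 W0 (ltW dl0); move: gW; rewrite sqrrD mulr2n; lra.
  - by rewrite lerD2l ler_wsqrtr// lerD2l lerN2.
have : 4^-1 * (dl * K) <= e.
  have -> : 4^-1 * (dl * K) = e * (K / (K + 1)) by rewrite /dl; field; rewrite gt_eqF// ltr_wpDl.
  by rewrite ler_piMr ?(ltW e0)// ler_pdivrMr ?ltr_wpDl// mul1r lerDl.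
lra.
Qed.

Lemma refined_bound_le (s t W : R) : 0 <= s -> 0 <= t -> 0 <= W -> (s - t) ^+ 2 <= W ^+ 2 ->
  refined_bound s t W <= 1 / 2 * (s + t) * W.
Proof.
move=> s0 t0 W0 stW.
suff : Num.sqrt (2 * s ^+ 2 + 2 * t ^+ 2 - W ^+ 2) <= s + t.
  move=> /(ler_wpM2l W0); rewrite /refined_bound; lra.
rewrite -[leRHS]ger0_norm ?addr_ge0// -sqrtr_sqr ler_wsqrtr//; move: stW; rewrite sqrrB sqrrD.
by rewrite !mulr2n; lra.
Qed.

Lemma refined_bound_tight (s t W : R) : 0 <= s -> 0 <= t -> 0 < W ->
  W ^+ 2 <= 2 * s ^+ 2 + 2 * t ^+ 2 ->
  1 / 2 * (s + t) * W <= refined_bound s t W -> W ^+ 2 <= (s - t) ^+ 2.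
Proof.
move=> s0 t0 W0 D0 H.
have {H} : s + t <= Num.sqrt (2 * s ^+ 2 + 2 * t ^+ 2 - W ^+ 2).
  by rewrite -(ler_pM2l W0); move: H; rewrite /refined_bound; lra.
rewrite -(@ler_pXn2r _ 2)// ?nnegrE ?addr_ge0 ?sqrtr_ge0//.
rewrite sqr_sqrtr ?subr_ge0//; rewrite sqrrB sqrrD !mulr2n; lra.
Qed.

End wasserstein.

(** * Quadratic test functions and the lower bound *)

Section quadratic.
Context (R : realType) (d : nat).
Implicit Types (x y m : 'rV[R]_d) (k : R).

Definition quadratic k m x : R := k / 2 * enorm (x - m) ^+ 2.

Lemma differentiable_quadratic k m x : differentiable (quadratic k m) x.
Proof.
have -> : quadratic k m = (k / 2) *:
    (\sum_(i < d) ((fun y : 'rV[R]_d => y 0 i) - cst (m 0 i)) ^+ 2 : 'rV[R]_d -> R).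
  apply/funext => y; rewrite /quadratic sqr_enorm fctE fct_sumE.
  by congr (_ * _); apply: eq_bigr => i _; rewrite !mxE expr2.
apply: differentiableZ; apply: differentiable_sum => i.
by apply: differentiableX; apply: differentiableB => //; exact: differentiable_coord.
Qed.

(** The partial derivative is read off the polynomial [s |-> quadratic k m (x + s *: e)],
    whose derivative at [0] is unique. *)
Lemma grad_quadratic k m x : grad (quadratic k m) x = k *: (x - m).
Proof.
apply/rowP => i; pose e : 'rV[R]_d := delta_mx 0 i.
have dot_e y : dot y e = y 0 i.
  rewrite /dot (bigD1 i)//= mxE !eqxx mulr1 big1 ?addr0// => j ji.
  by rewrite mxE eqxx (negbTE ji) mulr0.
have dq : differentiable (quadratic k m) (x + (0 : R) *: e) by exact: differentiable_quadratic.
have di := is_derive_id (0 : R) (1 : R).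
pose c0 := k / 2 * enorm (x - m) ^+ 2; pose c1 := k * (x - m) 0 i.
pose c2 := k / 2 * enorm e ^+ 2.
have dpoly := is_deriveD (is_deriveD (is_derive_cst c0 (0 : R) (1 : R)) (is_deriveZ c1 di))
  (is_deriveZ c2 (is_deriveX 2 di)).
have dline := is_derive_line dq.
rewrite scale0r addr0 (dot_e (grad _ _)) in dline.
rewrite -(@derive_val _ _ _ _ _ _ _ dline).
rewrite (_ : (fun s : R => _) =
  (cst c0 : R -> R) + c1 *: (id : R -> R) + c2 *: (id ^+ 2 : R -> R)); last first.
  apply/funext => s; rewrite /quadratic (_ : x + s *: e - m = (x - m) + s *: e); last first.
    by rewrite addrAC.
  rewrite sqr_enormD enormZ exprMn real_normK ?num_real// dotZr dot_e.
  by rewrite !fctE /c0 /c1 /c2 /GRing.scale/=; field.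
by rewrite (@derive_val _ _ _ _ _ _ _ dpoly) /c1 /GRing.scale/= expr1 !mxE; ring.
Qed.

Lemma C11_quadratic k m : `|k| = 1 -> C11 (quadratic k m) /\ (lip (grad (quadratic k m)) <= 1)%E.
Proof.
move=> k1.
have lipq : (lip (grad (quadratic k m)) <= 1)%E.
  apply: ge_ereal_sup => _ [[x y] /= xy <-].
  rewrite lee_fin !grad_quadratic -scalerBr opprB addrA subrK enormZ k1 mul1r.
  rewrite divff// gt_eqF// enorm_gt0// => /eqP; by rewrite subr_eq0 => /eqP.
split => //; split; last exact: le_lt_trans lipq (ltry _).
- by move=> x; exact: differentiable_quadratic.
- rewrite (_ : grad _ = (fun x : 'rV[R]_d => cst k x *: (id x - cst m x))); last first.
    by apply/funext => x; rewrite grad_quadratic.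
  move=> x; apply: continuousZ; first exact: cst_continuous.
  by apply: continuousB => //; exact: cst_continuous.
Qed.

Implicit Types mu nu : probability (Rd R d) R.

Lemma has_law_id mu : has_law mu id mu.
Proof. by split; [exact: measurable_id|]. Qed.

Lemma integral_quadratic k mu : P2 mu ->
  (\int[mu]_x (quadratic k (barycentre mu) x)%:E)%E = (k / 2 * var mu)%:E.
Proof.
move=> Pmu; have lmu := has_law_id mu.
have i2 := integrable_sqr_enorm (L2B (law_L2 lmu Pmu) (L2_cst mu (barycentre mu))).
rewrite EFin_Rintegral; last exact: integrableZ_fun.
by rewrite RintegralZl.
Qed.

Lemma Z2_ge_quadratic k mu nu : `|k| = 1 -> P2 mu -> P2 nu -> barycentre mu = barycentre nu ->
  ((k / 2 * (stddev nu ^+ 2 - stddev mu ^+ 2))%:E <= Z2 mu nu)%E.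
Proof.
move=> k1 Pmu Pnu bary; rewrite !sqr_stddev mulrBr EFinB -!integral_quadratic// bary.
by apply: ereal_sup_ubound; exists (quadratic k (barycentre nu)) => //; exact: C11_quadratic.
Qed.

Lemma Z2_ge_sqr_stddev mu nu : P2 mu -> P2 nu -> barycentre mu = barycentre nu ->
  ((1 / 2 * `|stddev mu ^+ 2 - stddev nu ^+ 2|)%:E <= Z2 mu nu)%E.
Proof.
move=> Pmu Pnu bary; set D := _ - _; have [D0|D0] := leP 0 D.
  rewrite ger0_norm// (_ : 1 / 2 * D = (-1) / 2 * (stddev nu ^+ 2 - stddev mu ^+ 2)).
    by apply: Z2_ge_quadratic => //; rewrite normrN1.
  by rewrite /D; ring.
rewrite ltr0_norm// (_ : 1 / 2 * - D = 1 / 2 * (stddev nu ^+ 2 - stddev mu ^+ 2)).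
  by apply: Z2_ge_quadratic => //; rewrite normr1.
by rewrite /D; ring.
Qed.

End quadratic.

(** * The inequality and its equality case *)

Section main_inequality.
Context (R : realType) (d : nat).
Implicit Types mu nu : probability (Rd R d) R.

Lemma sqr_stddevB_le_W2 mu nu (W : R) : P2 mu -> P2 nu -> barycentre mu = barycentre nu ->
  0 <= W -> W2 mu nu = W%:E -> (stddev mu - stddev nu) ^+ 2 <= W ^+ 2.
Proof.
move=> Pmu Pnu bary W0 WE; have [V [_ VE _ Vadh]] := W2P Pmu Pnu.
have -> : W = V by apply/EFin_inj; rewrite -WE VE.
apply/ler_addgt0Pr => e /Vadh[g cg ge].
exact: le_trans (sqr_stddevB_le_cost Pmu Pnu bary cg) (ltW ge).
Qed.

Lemma Z2_le mu nu : P2 mu -> P2 nu -> barycentre mu = barycentre nu ->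
  (Z2 mu nu <= (1 / 2 * (stddev mu + stddev nu))%:E * W2 mu nu)%E.
Proof.
move=> Pmu Pnu bary; have [W [W0 WE _ _]] := W2P Pmu Pnu.
apply: (le_trans (Z2_le_refined Pmu Pnu bary W0 WE)).
rewrite WE -EFinM lee_fin refined_bound_le ?stddev_ge0//.
exact: sqr_stddevB_le_W2 WE.
Qed.

(** Since [W2] is never below [`|stddev mu - stddev nu|], the hypothesis says that
    it attains its least possible value. *)
Lemma Z2_eq_of_W2_le mu nu (W : R) : P2 mu -> P2 nu -> barycentre mu = barycentre nu ->
  W2 mu nu = W%:E -> W <= `|stddev mu - stddev nu| ->
  (Z2 mu nu = (1 / 2 * (stddev mu + stddev nu))%:E * W2 mu nu)%E.
Proof.
move=> Pmu Pnu bary WE Wst; apply/eqP; rewrite eq_le Z2_le//=.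
apply: le_trans (Z2_ge_sqr_stddev Pmu Pnu bary).
have st0 : 0 <= stddev mu + stddev nu by rewrite addr_ge0 ?stddev_ge0.
rewrite WE -EFinM lee_fin subr_sqr normrM (ger0_norm st0).
rewrite [leRHS](_ : _ = 1 / 2 * (stddev mu + stddev nu) * `|stddev mu - stddev nu|).
  by rewrite ler_wpM2l// mulr_ge0.
by rewrite [in LHS](mulrC `|_|) mulrA.
Qed.

(** The common direction [Z] makes the statement symmetric in the two measures;
    it covers both dilations of one measure and pairs of two-point measures. *)
Lemma W2_collinear_le d0 (T : measurableType d0) (P : probability T R)
    (X Y : T -> Rd R d) (Z : T -> 'rV[R]_d) (a b : R) mu nu (W : R) :
  P2 mu -> P2 nu -> barycentre mu = barycentre nu -> has_law P X mu -> has_law P Y nu ->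
  L2 P Z -> 0 <= a -> 0 <= b ->
  (forall w, (X w : 'rV[R]_d) - barycentre mu = a *: Z w) ->
  (forall w, (Y w : 'rV[R]_d) - barycentre mu = b *: Z w) ->
  0 <= W -> W2 mu nu = W%:E -> W <= `|stddev mu - stddev nu|.
Proof.
move=> Pmu Pnu bary lX lY ZL2 a0 b0 XZ YZ W0 WE.
have sE c : 0 <= c -> Num.sqrt (msq P (fun w => c *: Z w)) = c * Num.sqrt (msq P Z).
  by move=> c0; rewrite msqZ// sqrtrM ?sqr_ge0// sqrtr_sqr ger0_norm.
have -> : stddev mu = a * Num.sqrt (msq P Z).
  by rewrite -sE// /stddev (law_var lX); under eq_fun do rewrite XZ.
have -> : stddev nu = b * Num.sqrt (msq P Z).
  by rewrite -sE// /stddev (law_var lY) -bary; under eq_fun do rewrite YZ.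
rewrite -(@ler_pXn2r _ 2)// ?nnegrE// (le_trans (W2_le_cost Pmu Pnu lX lY W0 WE))//.
rewrite real_normK ?num_real// -mulrBl exprMn sqr_sqrtr ?msq_ge0// -msqZ//.
rewrite le_eqVlt; apply/orP; left; apply/eqP; apply: eq_Rintegral => w _.
by rewrite scalerBl -XZ -YZ opprB addrA subrK.
Qed.

Lemma has_law_dilation d0 (T : measurableType d0) (P : probability T R)
    (X : T -> Rd R d) mu m lambda :
  has_law P X mu -> has_law P (dilation m lambda \o X) (pushforward mu (dilation m lambda)).
Proof.
move=> [mX lX]; split; first exact: measurableT_comp (measurable_dilation _ _) mX.
move=> A mA; apply: lX; rewrite -[X in measurable X]setTI.
exact: measurable_dilation.
Qed.

Lemma dilation_subE (m : 'rV[R]_d) lambda x :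
  (dilation m lambda x : 'rV[R]_d) - m = lambda *: ((x : 'rV[R]_d) - m).
Proof. by rewrite /dilation addrAC subrr add0r. Qed.

Lemma Z2_eq_of_dilation mu nu lambda : P2 mu -> P2 nu -> barycentre mu = barycentre nu ->
  0 <= lambda ->
  same_measure nu (pushforward mu (dilation (barycentre mu) lambda)) \/
  same_measure mu (pushforward nu (dilation (barycentre mu) lambda)) ->
  (Z2 mu nu = (1 / 2 * (stddev mu + stddev nu))%:E * W2 mu nu)%E.
Proof.
move=> Pmu Pnu bary l0 H; have [W [W0 WE _ _]] := W2P Pmu Pnu.
have L2c (mu' : probability (Rd R d) R) : P2 mu' ->
    L2 mu' (fun x : Rd R d => (x : 'rV[R]_d) - barycentre mu).
  by move=> Pm; apply: L2B; [exact: law_L2 (has_law_id mu') Pm|exact: L2_cst].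
apply: (Z2_eq_of_W2_le Pmu Pnu bary WE); case: H => H.
- have lY : has_law mu (dilation (barycentre mu) lambda) nu.
    by split; [exact: measurable_dilation|move=> A /H].
  apply: (W2_collinear_le (a := 1) (b := lambda)
    Pmu Pnu bary (has_law_id mu) lY (L2c _ Pmu)) => // x.
    by rewrite scale1r.
  exact: dilation_subE.
- have lX : has_law nu (dilation (barycentre mu) lambda) mu.
    by split; [exact: measurable_dilation|move=> A /H].
  apply: (W2_collinear_le (a := lambda) (b := 1)
    Pmu Pnu bary lX (has_law_id nu) (L2c _ Pnu)) => // x.
    exact: dilation_subE.
  by rewrite scale1r.
Qed.

Lemma dilation_of_vanishing_cost d0 (T : measurableType d0) (X Y : T -> Rd R d) mu nu m lambda :
  (forall e : R, 0 < e -> exists P : probability T R, [/\ has_law P X mu, has_law P Y nu &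
    (\int[P]_w (enorm ((Y w : 'rV[R]_d) - dilation m lambda (X w)) ^+ 2)%:E < e%:E)%E]) ->
  same_measure nu (pushforward mu (dilation m lambda)).
Proof.
move=> H.
pose D : {mfun Rd R d >-> Rd R d} := HB.pack (dilation m lambda)
  (isMeasurableFun.Build _ _ _ _ _ (measurable_dilation m lambda)).
apply: (@vanishing_cost_same_measure _ _ _ _ Y (dilation m lambda \o X) nu (distribution mu D)).
by move=> e /H[P [lX lY ge]]; exists P; split; [exact: lY|exact: has_law_dilation|exact: ge].
Qed.

(** Equality forces the distance to be [`|s - t|], and then couplings of nearly
    optimal cost concentrate on the graph of the dilation of ratio [t / s]. *)
Lemma dilation_of_Z2_eq mu nu : P2 mu -> P2 nu -> barycentre mu = barycentre nu ->
  (Z2 mu nu = (1 / 2 * (stddev mu + stddev nu))%:E * W2 mu nu)%E ->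
  exists2 lambda : R, 0 <= lambda &
  same_measure nu (pushforward mu (dilation (barycentre mu) lambda)) \/
  same_measure mu (pushforward nu (dilation (barycentre mu) lambda)).
Proof.
move=> Pmu Pnu bary ZE; have [W [W0 WE Wle Wadh]] := W2P Pmu Pnu.
set m := barycentre mu; set s := stddev mu; set t := stddev nu.
have s0 : 0 <= s by exact: stddev_ge0.
have t0 : 0 <= t by exact: stddev_ge0.
have [WZ|Wn0] := eqVneq W 0.
  exists 1 => //; left; apply: (@dilation_of_vanishing_cost _ _ fst snd) => e /Wadh[g cg].
  have [l1 l2] := couplings_has_law cg.
  rewrite WZ expr0n/= add0r => ge; exists g; split; [exact: l1|exact: l2|].
  rewrite -lte_fin in ge; apply: le_lt_trans ge.
  rewrite -(coupling_costE Pmu Pnu cg) le_eqVlt; apply/orP; left; apply/eqP.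
  by apply: eq_integral => z _; rewrite /dilation scale1r (addrC m) subrK enormBC.
have [sZ|sn0] := eqVneq s 0.
  exists 0 => //; right; apply: (@dilation_of_vanishing_cost _ _ snd fst) => e e0.
  have [g cg] := exists_coupling mu nu.
  have [l1 l2] := couplings_has_law cg; exists g; split; [exact: l2|exact: l1|].
  under eq_integral do rewrite /dilation scale0r addr0.
  rewrite EFin_msq -?law_var//; last by apply: L2B; [exact: law_L2 l1 Pmu|exact: L2_cst].
  by rewrite -sqr_stddev -/s sZ expr0n.
have Wp : 0 < W by rewrite lt_neqAle eq_sym Wn0.
have sp : 0 < s by rewrite lt_neqAle eq_sym sn0.
have Wst : W ^+ 2 <= (s - t) ^+ 2.
  apply: refined_bound_tight => //.
    have [g cg] := exists_coupling mu nu.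
    exact: le_trans (Wle _ cg) (cost_le_sqr_stddev Pmu Pnu bary cg).
  by rewrite -lee_fin EFinM -WE -ZE; exact: Z2_le_refined.
have l0 : 0 <= t / s by rewrite divr_ge0.
exists (t / s) => //; left; apply: (@dilation_of_vanishing_cost _ _ fst snd) => e e0.
have l1p : 0 < t / s + 1 by rewrite ltr_wpDl.
(* The excess of the cost over W ^+ 2 gets multiplied by t / s below; adding 1 keeps
   the divisor positive when t = 0. *)
have [g cg ge] := Wadh _ (divr_gt0 e0 l1p).
have [l1 l2] := couplings_has_law cg; exists g; split; [exact: l1|exact: l2|].
have X2 := L2B (law_L2 l1 Pmu) (L2_cst g m); have Y2 := L2B (law_L2 l2 Pnu) (L2_cst g m).
have costE : cost g = s ^+ 2 + t ^+ 2 -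
    2 * \int[g]_z dot (((z.1 : Rd R d) : 'rV[R]_d) - m) (((z.2 : Rd R d) : 'rV[R]_d) - m).
  rewrite !sqr_stddev (law_var l1) (law_var l2) -bary -msqB//.
  by apply: eq_Rintegral => z _; rewrite opprB addrA subrK.
have dE : forall z : Rd R d * Rd R d, ((z.2 : 'rV[R]_d) - dilation m (t / s) z.1) =
    (((z.2 : Rd R d) : 'rV[R]_d) - m) - (t / s) *: (((z.1 : Rd R d) : 'rV[R]_d) - m).
  by move=> z; rewrite /dilation opprD addrA.
under eq_integral do rewrite dE.
rewrite EFin_msq; last by apply: L2B => //; exact: L2Z.
rewrite lte_fin msqB//; last exact: L2Z.
rewrite msqZ//.
have -> : msq g (fun z => ((z.1 : Rd R d) : 'rV[R]_d) - m) = s ^+ 2.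
  by rewrite sqr_stddev (law_var l1).
have -> : msq g (fun z => ((z.2 : Rd R d) : 'rV[R]_d) - m) = t ^+ 2.
  by rewrite sqr_stddev (law_var l2) -bary.
under eq_Rintegral do rewrite dotZr dotC.
rewrite RintegralZl//; last exact: integrable_dot.
move: costE; set I := Rintegral _ _ _ => costE.
have -> : t ^+ 2 + (t / s) ^+ 2 * s ^+ 2 - 2 * (t / s * I) = t / s * (cost g - (s - t) ^+ 2).
  by rewrite costE; field.
apply: (@le_lt_trans _ _ (t / s * (e / (t / s + 1)))).
  by rewrite ler_wpM2l//; move: ge Wst; lra.
by rewrite mulrCA gtr_pMr// ltr_pdivrMr// mul1r ltrDl.
Qed.

End main_inequality.

(** * Optimality of the constant *)

Lemma Rintegral_cst_probability d0 (T : measurableType d0) (R : realType)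
  (P : probability T R) (c : R) : \int[P]_w c = c.
Proof. by rewrite Rintegral_cst// [X in fine X]probability_setT mulr1. Qed.

Section optimality.
Context (R : realType) (d : nat).
Implicit Types mu nu : probability (Rd R d) R.

Lemma Z2_ge0 mu nu : P2 mu -> P2 nu -> barycentre mu = barycentre nu -> (0 <= Z2 mu nu)%E.
Proof.
move=> Pmu Pnu bary; apply: le_trans (Z2_ge_sqr_stddev Pmu Pnu bary).
by rewrite lee_fin mulr_ge0.
Qed.

(** With the conventions [0^-1 = +oo] and [0 * +oo = 0] of extended reals, a pair at
    distance zero has ratio zero, since then [Z2] vanishes too. *)
Lemma ratio_le mu nu (c : R) : 0 <= c -> P2 mu -> P2 nu -> barycentre mu = barycentre nu ->
  (Z2 mu nu <= c%:E * W2 mu nu)%E -> (Z2 mu nu / W2 mu nu <= c%:E)%E.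
Proof.
move=> c0 Pmu Pnu bary; have [W [W0 -> _ _]] := W2P Pmu Pnu; rewrite inver.
have [->|Wn0] := eqVneq W 0 => ZW.
  rewrite (_ : Z2 mu nu = 0%E) ?mul0e ?lee_fin//.
  by apply/eqP; rewrite eq_le Z2_ge0// andbT -[leRHS](mule0 c%:E).
by rewrite lee_pdivrMr// lt_neqAle eq_sym Wn0.
Qed.

Lemma ratios_le (a b : R) r : ratios d a b r -> (r <= (1 / 2 * (a + b))%:E)%E.
Proof.
move=> [mu [nu [[Pmu Pnu] [sa tb] _ [bmu bnu] ->]]].
have bary : barycentre mu = barycentre nu by rewrite bmu bnu.
have k0 : 0 <= 1 / 2 * (stddev mu + stddev nu) by rewrite mulr_ge0// addr_ge0 ?stddev_ge0.
apply: (le_trans (ratio_le k0 Pmu Pnu bary (Z2_le Pmu Pnu bary))).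
by rewrite lee_fin ler_wpM2l// lerD.
Qed.

Lemma ratios_ge0 (a b : R) r : ratios d a b r -> (0 <= r)%E.
Proof.
move=> [mu [nu [[Pmu Pnu] _ _ [bmu bnu] ->]]].
have [W [W0 WE _ _]] := W2P Pmu Pnu.
by rewrite mule_ge0 ?inve_ge0 ?WE ?lee_fin// Z2_ge0// bmu bnu.
Qed.

Lemma same_measure_stddev mu nu : barycentre mu = barycentre nu ->
  same_measure mu nu -> stddev mu = stddev nu.
Proof.
move=> bary mn; have lmu : has_law mu id nu by split; [exact: measurable_id|].
by rewrite /stddev (law_var lmu) (law_var (has_law_id mu)) bary.
Qed.

Notation coin := (bernoulli_prob (2^-1 : R)).

Let half01 : 0 <= (2^-1 : R) <= 1.
Proof. by rewrite invr_ge0 ler0n invf_le1// ler1n. Qed.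

Lemma coin_Lfun2 (f : bool -> R) : f \in Lfun coin 2%:E.
Proof.
apply: Lfun2P => //; rewrite integral_bernoulli_prob// => [|b]; last by rewrite lee_fin sqr_ge0.
by rewrite -!EFinM -EFinD ltry.
Qed.

Lemma coin_odd_integral (f : bool -> R) : f false = - f true ->
  \int[coin]_b f b = 0.
Proof.
move=> fF; have fi := Lfun2_integrable (coin_Lfun2 f).
have ci : coin.-integrable setT (EFin \o cst `|f true|).
  by apply: finite_measure_integrable_cst.
(* Shifting by |f true| makes the integrand nonnegative. *)
apply: (@addIr _ `|f true|); rewrite add0r.
transitivity (\int[coin]_b (f b + cst `|f true| b)).
  by rewrite RintegralD// Rintegral_cst_probability.
rewrite /Rintegral integral_bernoulli_prob//= => [|b].
  by rewrite fF /unstable.onem; field.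
have : `|f b| = `|f true| by case: b; rewrite ?fF ?normrN.
by move=> <-; rewrite lee_fin -lerBlDr sub0r; have := ler_norm (- f b); rewrite normrN; lra.
Qed.

Definition signed (e : 'rV[R]_d) (b : bool) : 'rV[R]_d := (if b then 1 else -1) *: e.

Definition two_point_map (e : 'rV[R]_d) (a : R) (b : bool) : Rd R d := a *: signed e b.

Lemma measurable_two_point_map e a : measurable_fun setT (two_point_map e a).
Proof. by []. Qed.

Definition two_point e a : probability (Rd R d) R := distribution coin
  (HB.pack (two_point_map e a)
    (isMeasurableFun.Build _ _ _ _ _ (measurable_two_point_map e a)) : {mfun bool >-> Rd R d}).

Lemma has_law_two_point e a : has_law coin (two_point_map e a) (two_point e a).
Proof. by split. Qed.

Lemma L2_signed e : L2 coin (signed e).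
Proof. by move=> i; exact: coin_Lfun2. Qed.

Lemma P2_two_point e a : P2 (two_point e a).
Proof. by apply: (law_P2 (has_law_two_point e a)); exact: L2Z (L2_signed e). Qed.

Lemma barycentre_two_point e a : barycentre (two_point e a) = 0.
Proof.
rewrite (law_barycentre (has_law_two_point e a)); apply/rowP => i; rewrite !mxE.
by apply: coin_odd_integral; rewrite /two_point_map/= !mxE; ring.
Qed.

Lemma stddev_two_point e a : enorm e = 1 -> 0 <= a -> stddev (two_point e a) = a.
Proof.
move=> e1 a0; rewrite /stddev (law_var (has_law_two_point e a)) barycentre_two_point.
under eq_fun do rewrite subr0.
rewrite msqZ; last exact: L2_signed.
rewrite sqrtrM ?sqr_ge0// sqrtr_sqr ger0_norm// /msq.
rewrite (eq_Rintegral _ (g := cst 1)) => [|b _]; last first.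
  by rewrite enormZ e1 mulr1; case: b; rewrite ?normrN normr1 expr1n.
by rewrite Rintegral_cst_probability sqrtr1 mulr1.
Qed.

Lemma ratios_two_point (d_ge1 : (1 <= d)%N) (a b a' b' : R) :
  0 <= a' <= a -> 0 <= b' <= b -> a' != b' -> ratios d a b (1 / 2 * (a' + b'))%:E.
Proof.
move=> /andP[a'0 a'a] /andP[b'0 b'b] ab'.
pose e : 'rV[R]_d := delta_mx 0 (Ordinal d_ge1).
have e1 : enorm e = 1.
  rewrite /enorm (bigD1 (Ordinal d_ge1))//= mxE !eqxx expr1n big1 ?addr0 ?sqrtr1// => i ie.
  by rewrite mxE eqxx (negbTE ie) expr0n.
set mu := two_point e a'; set nu := two_point e b'.
have smu : stddev mu = a' by exact: stddev_two_point.
have tnu : stddev nu = b' by exact: stddev_two_point.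
have bmu : barycentre mu = 0 by exact: barycentre_two_point.
have bnu : barycentre nu = 0 by exact: barycentre_two_point.
have bary : barycentre mu = barycentre nu by rewrite bmu bnu.
have Pmu : P2 mu by exact: P2_two_point.
have Pnu : P2 nu by exact: P2_two_point.
have [W [W0 WE _ _]] := W2P Pmu Pnu.
exists mu, nu; split => //; first by rewrite smu tnu.
  by move=> /(same_measure_stddev bary); rewrite smu tnu => /eqP; rewrite (negbTE ab').
rewrite (Z2_eq_of_W2_le Pmu Pnu bary WE); last first.
  apply: (W2_collinear_le Pmu Pnu bary (has_law_two_point e a') (has_law_two_point e b')
    (L2_signed e) a'0 b'0 _ _ W0 WE) => w; by rewrite bmu subr0.
have Wn0 : W != 0.
  apply/eqP => WZ; have := sqr_stddevB_le_W2 Pmu Pnu bary W0 WE.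
  by rewrite WZ expr0n/= smu tnu leNgt exprn_even_gt0//= subr_eq0 ab'.
by rewrite smu tnu WE inver (negbTE Wn0) -!EFinM mulfK.
Qed.

Lemma h_eq (d_ge1 : (1 <= d)%N) (a b : R) : 0 <= a -> 0 <= b ->
  h d a b = (1 / 2 * (a + b))%:E.
Proof.
move=> a0 b0.
have ub : (ereal_sup (ratios d a b) <= (1 / 2 * (a + b))%:E)%E.
  by apply: ge_ereal_sup => r; exact: ratios_le.
have h0 : (0 <= h d a b)%E.
  rewrite /h; case: ifPn => // /set0P[r rr].
  exact: le_trans (ratios_ge0 rr) (ereal_sup_ubound rr).
apply/eqP; rewrite eq_le; apply/andP; split.
  by rewrite /h; case: ifPn => // _; rewrite lee_fin mulr_ge0// addr_ge0.
have hge r : ratios d a b r -> (r <= h d a b)%E.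
  move=> rr; rewrite /h; case: ifPn => [/eqP r0|_]; first by rewrite r0 in rr.
  exact: ereal_sup_ubound.
have [ab|ab] := eqVneq a b; last by apply: hge; apply: ratios_two_point; rewrite ?a0 ?b0 ?lexx.
have [az|an0] := eqVneq a 0; first by move: h0; rewrite -ab az addr0 mulr0.
have ap : 0 < a by rewrite lt_neqAle eq_sym an0.
(* For a = b the two measures would coincide; shrinking one by at most e, while
   keeping its standard deviation nonnegative, costs at most e / 2 in the ratio. *)
apply/lee_addgt0Pr => e e0; pose a' := a - Num.min e a.
have m0 : 0 < Num.min e a by rewrite lt_min e0.
have me : Num.min e a <= e by rewrite ge_min lexx.
have ma : Num.min e a <= a by rewrite ge_min lexx orbT.
have := hge _ (@ratios_two_point d_ge1 a b a' b _ _ _).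
move=> H; apply: (@le_trans _ _ ((1 / 2 * (a' + b))%:E + e%:E)%E).
  by rewrite -EFinD lee_fin /a'; lra.
rewrite leeD2r// H//.
- by rewrite subr_ge0 ma lerBlDr lerDl ltW.
- by rewrite b0 lexx.
- by rewrite -ab lt_eqF// ltrBlDr ltrDl.
Qed.

End optimality.

Unset Implicit Arguments.
Local Open Scope ereal_scope.

Theorem theorem4p1 (R : realType) (d : nat) (d_ge1 : (1 <= d)%N) :
  [/\ forall mu nu : probability (Rd R d) R,
        P2 mu -> P2 nu -> barycentre mu = barycentre nu ->
        Z2 mu nu <= (1 / 2 * (stddev mu + stddev nu))%:E * W2 mu nu,
      forall a b : R, (0 <= a)%R -> (0 <= b)%R ->
        h d a b = (1 / 2 * (a + b))%:E &
      forall mu nu : probability (Rd R d) R,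
        P2 mu -> P2 nu -> barycentre mu = barycentre nu ->
        Z2 mu nu = (1 / 2 * (stddev mu + stddev nu))%:E * W2 mu nu <->
        exists2 lambda : R, (0 <= lambda)%R &
          same_measure nu (pushforward mu (dilation (barycentre mu) lambda)) \/
          same_measure mu (pushforward nu (dilation (barycentre mu) lambda))].
Proof.
split; first exact: Z2_le.
- by move=> a b; exact: h_eq.
- move=> mu nu Pmu Pnu bary; split; first exact: dilation_of_Z2_eq.
  by case=> lambda l0; exact: Z2_eq_of_dilation.
Qed.
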